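(* Let $1\le t\le k$ be integers and let $a_1,b_1,s_2,\dots,s_k,N_1,N_2$ be positive integers with $\frac{N_1}{a_1}=\frac{N_2}{b_1}$. If there exist an $\mathrm{OA}(N_1,a_1s_2\cdots s_k,t)$ and an $\mathrm{OA}(N_2,b_1s_2\cdots s_k,t)$, then there exists an optimal $$\mathrm{NOA}\bigl((N_1+N_2,N_1),\,k,\,((a_1+b_1)s_2\cdots s_k,\ a_1s_2\cdots s_k),\,t\bigr).$$
   Context: For a positive integer $s$, $\mathbb{Z}_s=\{0,1,\dots,s-1\}$. Arrays are nonempty finite multisets of rows; $|A|$ counts rows with multiplicity. Let $G=\mathbb{Z}_{s_1}\times\cdots\times\mathbb{Z}_{s_k}$; for $I=\{i_1,\dots,i_t\}\subseteq\{1,\dots,k\}$ let $G_I=\mathbb{Z}_{s_{i_1}}\times\cdots\times\mathbb{Z}_{s_{i_t}}$ and let $\pi_I:G\to G_I$ be the coordinate projection. For $1\le t\le k$, a finite multiset $A$ of elements of $G$ is an orthogonal array of strength $t$ over $G$, denoted $\mathrm{OA}(|A|,s_1s_2\cdots s_k,t)$, if for every $I$ with $|I|=t$ there is a positive integer $\lambda_I$ with $|\{\alpha\in A:\pi_I(\alpha)=\beta\}|=\lambda_I$ for all $\beta\in G_I$ (counted with multiplicity). In this notation $s_1s_2\cdots s_k$ is the list of numbers of levels of the $k$ factors, not a product; $(a_1+b_1)s_2\cdots s_k$ means that the first factor has $a_1+b_1$ levels and factor $i\ge2$ has $s_i$ levels. Nested orthogonal array: let $S_i\ge R_i$ be positive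 integers for $1\le i\le k$, with strict inequality for at least one $i$. An $\mathrm{NOA}((N,M),k,(S_1S_2\cdots S_k,R_1R_2\cdots R_k),t)$ is an $\mathrm{OA}(N,S_1\cdots S_k,t)$, $A$, over $\mathbb{Z}_{S_1}\times\cdots\times\mathbb{Z}_{S_k}$ that contains a subarray (sub-multiset of rows) $B$ whose rows lie in $\prod_i\{0,\dots,R_i-1\}$ and which is an $\mathrm{OA}(M,R_1\cdots R_k,t)$ over $\mathbb{Z}_{R_1}\times\cdots\times\mathbb{Z}_{R_k}$. Optimality: with the factors indexed so that $\frac{S_1}{R_1}=\max_i\frac{S_i}{R_i}$ (which holds for the array in the claim), such an NOA is called optimal if $N$ equals $$M\sum_{i=0}^{t/2}\sum_{\substack{I\subseteq\{1,\dots,k\}\\|I|=i}}\prod_{j\in I}\Bigl(\frac{S_j}{R_j}-1\Bigr)\quad\text{when } t \text{ is even},$$ $$M\left[\sum_{i=0}^{\lfloor t/2\rfloor}\sum_{\substack{I\subseteq\{1,\dots,k\}\\|I|=i}}\prod_{j\in I}\Bigl(\frac{S_j}{R_j}-1\Bigr)+\Bigl(\frac{S_1}{R_1}-1\Bigr)\sum_{\substack{I\subseteq\{2,\dots,k\}\\|I|=\lfloor t/2\rfloor}}\prod_{j\in I}\Bigl(\frac{S_j}{R_j}-1\Bigr)\right]\quad\text{when } t\text{ is odd}.$$ Empty products equal $1$. *)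

(* Defs.v *)
From HB Require Import structures.
From mathcomp Require Import all_boot all_order all_algebra.
From mathcomp Require Import finmap multiset.

Set Implicit Arguments.
Unset Strict Implicit.
Unset Printing Implicit Defensive.

Import GRing.Theory Num.Theory.

Local Open Scope nat_scope.
Local Open Scope mset_scope.

(* Rows have natural-number entries, so that a row of the product of the
   Z_(R_i) literally is a row of the product of the Z_(S_i) when R_i <= S_i;
   membership in a given product is the predicate [in_levels] below.  Factors
   are numbered from 0. *)
Definition oa_row (k : nat) := {ffun 'I_k -> nat}.

(* G_I, and the projection pi_I, use the members of I themselves as indices. *)
Definition subrow (k : nat) (I : {set 'I_k}) :=
  {ffun {i : 'I_k | i \in I} -> nat}.

Definition in_levels (k : nat) (s : k.-tuple nat) (x : oa_row k) : Prop :=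
  forall i : 'I_k, x i < tnth s i.

Definition sub_in_levels (k : nat) (s : k.-tuple nat) (I : {set 'I_k})
    (y : subrow I) : Prop :=
  forall i : {i : 'I_k | i \in I}, y i < tnth s (val i).

Definition proj (k : nat) (I : {set 'I_k}) (x : oa_row k) : subrow I :=
  [ffun i : {i : 'I_k | i \in I} => x (val i)].

(* A multiset coerces to the sequence that repeats each element according to
   its multiplicity: [size] and [count] count with multiplicity. *)
Definition is_OA (N k : nat) (s : k.-tuple nat) (t : nat) (A : {mset oa_row k}) :
    Prop :=
  [/\ A != mset0,
      size A = N,
      forall x : oa_row k, x \in A -> in_levels s x
    & forall I : {set 'I_k}, #|I| = t ->
        exists2 lambda : nat, 0 < lambda &
          forall y : subrow I, sub_in_levels s y ->
            count (fun x : oa_row k => proj I x == y) A = lambda].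

Definition is_NOA (N M k : nat) (S R : k.-tuple nat) (t : nat)
    (A : {mset oa_row k}) : Prop :=
  [/\ forall i : 'I_k, 0 < tnth R i <= tnth S i,
      exists i : 'I_k, tnth R i < tnth S i,
      is_OA N S t A
    & exists2 B : {mset oa_row k}, B `<=` A & is_OA M R t B].

Section Optimality.

Local Open Scope ring_scope.

Definition level_ratio (k : nat) (S R : k.-tuple nat) (i : 'I_k) : rat :=
  (tnth S i)%:R / (tnth R i)%:R.

Definition NOA_bound (M k : nat) (S R : k.+1.-tuple nat) (t : nat) : rat :=
  let r := level_ratio S R in
  let main := \sum_(0 <= i < (t./2).+1)
                \sum_(I : {set 'I_k.+1} | #|I| == i)
                  \prod_(j in I) (r j - 1) in
  if odd t then
    M%:R * (main
            + (r ord0 - 1)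
              * \sum_(I : {set 'I_k.+1} | (ord0 \notin I) && (#|I| == t./2))
                  \prod_(j in I) (r j - 1))
  else M%:R * main.

(* Factor 0 is required to have the largest ratio S_i / R_i. *)
Definition is_optimal_NOA (N M k : nat) (S R : k.+1.-tuple nat) (t : nat)
    (A : {mset oa_row k.+1}) : Prop :=
  [/\ is_NOA N M S R t A,
      forall i : 'I_k.+1, level_ratio S R i <= level_ratio S R ord0
    & N%:R = NOA_bound M S R t].

End Optimality.

(* Main.v *)
(* Enlarge the first factor to a1 + b1 levels by juxtaposing A with
   the copy of B whose first entries are increased by a1.  The index of a
   strength-t array on the set I is N divided by the product of the levels in
   I, so N1/a1 = N2/b1 says exactly that A and B have equal indices on each I
   containing the first factor; on the other I the indices add.  Only the ratio
   of the first factor differs from 1, so at most the empty set and {first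
   factor} contribute to the bound, which is N1 (1 + b1/a1) = N1 + N2. *)
Require Import Defs.
From mathcomp Require Import all_boot all_order all_algebra.
From mathcomp Require Import finmap multiset.
From mathcomp Require Import ring.

Import GRing.Theory Num.Theory.

Local Open Scope nat_scope.
Local Open Scope mset_scope.

(** Double counting of the pairs of a point of G_I and a row of [A] above it: each row lies above
    exactly one point, and each point has [lambda] rows above it. *)
Lemma size_eq_prod_levels (k : nat) (s : k.-tuple nat) (I : {set 'I_k})
    (lambda : nat) (A : seq (oa_row k)) :
  (forall x, x \in A -> in_levels s x) ->
  (forall y : subrow I, sub_in_levels s y ->
     count (fun x => proj I x == y) A = lambda) ->
  size A = (\prod_(i : {i : 'I_k | i \in I}) tnth s (val i)) * lambda.
Proof.
move=> lvA cntA.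
(* [subrow I] is infinite, so [D] serves as a finite model of G_I to sum over, and [emb] includes it
   in [subrow I]. *)
pose D := {dffun forall i : {i : 'I_k | i \in I}, 'I_(tnth s (val i))}.
pose emb (d : D) : subrow I := [ffun i => val (d i)].
have cardD : #|{: D}| = \prod_(i : {i : 'I_k | i \in I}) tnth s (val i).
  rewrite card_dep_ffun foldrE big_map big_enum /=.
  by apply: eq_bigr => i _; rewrite card_ord.
rewrite -cardD -sum_nat_const -sum1_size.
transitivity (\sum_(d : D) \sum_(x <- A) (proj I x == emb d)); last first.
  apply: eq_bigr => d _; rewrite -(cntA (emb d)).
    by rewrite -sum1_count [RHS]big_mkcond; apply: eq_bigr => x _; case: eqP.
  by move=> i; rewrite ffunE ltn_ord.
rewrite exchange_big /= big_seq [RHS]big_seq; apply: eq_bigr => x /lvA lvx.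
(* The levels of [x] bound its entries, so its projection is a point [d0] of [D], the only one
   contributing to the inner sum. *)
pose d0 : D := [ffun i => Ordinal (lvx (val i))].
have emb_d0 : proj I x = emb d0 by apply/ffunP => i; rewrite !ffunE.
rewrite (bigD1 d0) //= emb_d0 eqxx big1 // => d /eqP neq_d.
case: eqP => // /ffunP eq_emb; case: neq_d; apply/ffunP => i.
by apply/val_inj; have := eq_emb i; rewrite !ffunE.
Qed.

Definition shift_row (k a : nat) (x : oa_row k.+1) : oa_row k.+1 :=
  [ffun i => if i == ord0 then a + x i else x i].

Lemma proj_shift_row_id (k a : nat) (I : {set 'I_k.+1}) (x : oa_row k.+1) :
  ord0 \notin I -> proj I (shift_row k a x) = proj I x.
Proof.
move=> I0; apply/ffunP => -[i iI]; rewrite !ffunE /=.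
by case: eqP => // i0; rewrite i0 (negPf I0) in iI.
Qed.

Lemma level_cons_eq (k a b : nat) (s : k.-tuple nat) (i : 'I_k.+1) :
  i != ord0 -> tnth [tuple of a :: s] i = tnth [tuple of b :: s] i.
Proof. by case: (unliftP ord0 i) => [j ->|->] // _; rewrite !tnthS. Qed.

Definition stack (k a : nat) (A B : {mset oa_row k.+1}) : {mset oa_row k.+1} :=
  seq_mset (A ++ map (shift_row k a) B).

Lemma perm_stack (k a : nat) (A B : {mset oa_row k.+1}) :
  perm_eq (stack k a A B) (A ++ map (shift_row k a) B).
Proof. exact: perm_eq_seq_mset. Qed.

Lemma is_OA_stack (k t a b N1 N2 : nat) (s : k.-tuple nat)
    (A B : {mset oa_row k.+1}) :
  0 < a -> 0 < b -> (forall i, 0 < tnth s i) -> N1 * b = N2 * a ->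
  is_OA N1 [tuple of a :: s] t A -> is_OA N2 [tuple of b :: s] t B ->
  is_OA (N1 + N2) [tuple of (a + b) :: s] t (stack k a A B).
Proof.
move=> a0 b0 s0 eqN [A0 szA lvA cntA] [B0 szB lvB cntB].
have permC := perm_stack k a A B.
have sizeC : size (stack k a A B) = N1 + N2.
  by rewrite (perm_size permC) size_cat size_map szA szB.
split=> // [|x|I cardI].
- case: (mset_0Vmem A) A0 => [->|[x xA] _]; first by rewrite eqxx.
  apply/eqP => C0; have := perm_mem permC x.
  by rewrite C0 enum_mset0 mem_cat xA.
- rewrite (perm_mem permC) mem_cat => /orP[/lvA lvx i|/mapP[y /lvB lvy ->] i].
    case: (eqVneq i ord0) (lvx i) => [-> |i0]; last by rewrite (level_cons_eq _ _ (a + b)).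
    by rewrite !tnth0 => /leq_trans; apply; rewrite leq_addr.
  rewrite ffunE; case: (eqVneq i ord0) (lvy i) => [-> |i0].
    by rewrite !tnth0 ltn_add2l.
  by rewrite (level_cons_eq _ _ (a + b)).
have [lA lA0 eqA] := cntA I cardI; have [lB lB0 eqB] := cntB I cardI.
have cntC (y : subrow I) : count (fun x => proj I x == y) (stack k a A B) =
    count (fun x => proj I x == y) A +
    count (fun x => proj I (shift_row k a x) == y) B.
  by rewrite (permP permC) count_cat count_map.
(* If [I] omits the first factor, the projection does not see the shift, and every point receives
   rows from both arrays. *)
have [I0|I0] := boolP (ord0 \in I); last first.
  have lv (c : nat) (y : subrow I) : sub_in_levels [tuple of (a + b) :: s] y ->
      sub_in_levels [tuple of c :: s] y.
    move=> lvy i; rewrite (level_cons_eq _ _ (a + b)) //.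
    by apply: contraNneq I0 => <-; apply: (valP i).
  exists (lA + lB) => [|y lvy]; first by rewrite addn_gt0 lA0.
  rewrite cntC eqA; last exact: lv lvy.
  under eq_count => x do rewrite proj_shift_row_id //.
  by rewrite eqB //; exact: lv lvy.
pose z : {i : 'I_k.+1 | i \in I} := Sub ord0 I0.
(* With [P] the product of the levels in [I] other than the first, N1 = a P lA and N2 = b P lB; the
   hypothesis [eqN] then allows cancelling the positive factor a b P. *)
have eq_lambda : lA = lB.
  have eqN1 := size_eq_prod_levels _ _ _ _ _ lvA eqA.
  have eqN2 := size_eq_prod_levels _ _ _ _ _ lvB eqB.
  rewrite szA (bigD1 z) //= tnth0 in eqN1.
  rewrite szB (bigD1 z) //= tnth0 in eqN2.
  rewrite (eq_bigr (fun i => tnth [tuple of a :: s] (val i))) in eqN2; last first.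
    by move=> i iz; apply: level_cons_eq.
  set P := \prod_(i | _) _ in eqN1 eqN2.
  have P0 : 0 < P.
    apply: prodn_cond_gt0 => i _.
    suff lv0 j : 0 < tnth [tuple of a :: s] j by apply: lv0.
    by case: (unliftP ord0 j) => [m ->|->]; rewrite ?tnthS ?tnth0.
  move: eqN; rewrite eqN1 eqN2.
  have -> : a * P * lA * b = (a * b * P) * lA by ring.
  have -> : b * P * lB * a = (a * b * P) * lB by ring.
  by move/eqP; rewrite eqn_pmul2l ?muln_gt0 ?a0 ?b0 // => /eqP.
exists lA => // y lvy; rewrite cntC.
have lvyi i : val i != ord0 -> forall c, y i < tnth [tuple of c :: s] (val i).
  by move=> i0 c; rewrite (level_cons_eq _ _ (a + b)).
(* The first entry of [y] decides which array contributes: below [a] only rows of [A] can match,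
   from [a] on only shifted rows of [B]. *)
have [ya|ya] := ltnP (y z) a.
  rewrite eqA; last first.
    move=> i; case: (eqVneq (val i) ord0) => [i0|/lvyi]; last exact.
    by rewrite i0 tnth0 (_ : i = z) //; apply: val_inj.
  rewrite [X in _ + X](_ : _ = 0) ?addn0 //.
  apply/eqP; rewrite -leqn0 leqNgt -has_count; apply/hasPn => x _.
  by apply: contraTneq ya => <-; rewrite !ffunE eqxx -leqNgt leq_addr.
rewrite (_ : count _ A = 0) ?add0n; last first.
  apply/eqP; rewrite -leqn0 leqNgt -has_count; apply/hasPn => x /lvA/(_ ord0).
  by rewrite tnth0; apply: contraTneq => eqy; move: ya; rewrite -eqy ffunE -leqNgt.
(* [y'] undoes the shift: a shifted row projects to [y] exactly when the original row of [B]
   projects to [y']. *)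
pose y' : subrow I := [ffun i => if val i == ord0 then y i - a else y i].
rewrite eq_lambda -(eqB y').
  apply: eq_count => x; apply/eqP/eqP => /ffunP eqy; apply/ffunP => i;
    have := eqy i; rewrite !ffunE; case: eqP => // i0; first by move=> <-; rewrite addKn.
  have -> : i = z by apply: val_inj.
  by move=> ->; rewrite subnKC.
move=> i; rewrite ffunE; case: (eqVneq (val i) ord0) => [i0|/lvyi]; last exact.
have -> : i = z by apply: val_inj.
by rewrite tnth0 ltn_subLR //; have := lvy z; rewrite tnth0.
Qed.

Local Open Scope ring_scope.

(** A product over [I] vanishes as soon as [I] contains an index other than [z], which leaves the
    empty set and the singleton of [z]. The bound [n.+2] ensures that both sizes 0 and 1 occur. *)
Lemma sum_prod_single_support (R : comNzRingType) (T : finType) (z : T)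
    (r : T -> R) (n : nat) :
  (forall j, j != z -> r j = 0) ->
  \sum_(0 <= i < n.+2) \sum_(I : {set T} | #|I| == i) \prod_(j in I) r j =
  1 + r z.
Proof.
move=> r0.
have prod0 (I : {set T}) : I != finset.set0 -> I != [set z]%SET ->
    \prod_(j in I) r j = 0.
  move=> /set0Pn[j jI] Iz.
  have [/existsP[m /andP[mI mz]]|/existsPn all_z] :=
      boolP [exists m, (m \in I) && (m != z)].
    by rewrite (bigD1 m) //= r0 ?mul0r.
  case/eqP: Iz; apply/setP => m; rewrite finset.in_set1.
  apply/idP/eqP => [mI|->]; first by have := all_z m; rewrite mI negbK => /eqP.
  by have := all_z j; rewrite jI negbK => /eqP <-.
rewrite big_nat_recl // big_nat_recl // [X in _ + (_ + X)]big1_seq ?addr0; last first.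
  move=> i _; apply: big1 => I /eqP cI; apply: prod0.
    by rewrite -cards_eq0 cI.
  by apply: contraPneq cI => ->; rewrite cards1.
congr (_ + _).
  rewrite (eq_bigl (pred1 finset.set0)); last by move=> I; rewrite /= cards_eq0.
  by rewrite big_pred1_eq big_set0.
rewrite (bigD1 [set z]%SET) ?cards1 //= big_set1 big1 ?addr0 // => I /andP[/eqP cI Iz].
by apply: prod0 => //; rewrite -cards_eq0 cI.
Qed.

Lemma NOA_bound_single_factor (M k t a c : nat) (s : k.-tuple nat) :
  (0 < a)%N -> (forall i, 0 < tnth s i)%N -> (0 < t)%N ->
  NOA_bound M [tuple of c :: s] [tuple of a :: s] t = M%:R * (c%:R / a%:R).
Proof.
move=> a0 s0 t0; rewrite /NOA_bound.
set r := level_ratio _ _.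
have r0 : r ord0 = c%:R / a%:R by rewrite /r /level_ratio !tnth0.
have r1 j : j != ord0 -> r j - 1 = 0.
  case: (unliftP ord0 j) => [i ->|->] // _.
  by rewrite /r /level_ratio !tnthS divff ?subrr // pnatr_eq0 -lt0n.
have main n := sum_prod_single_support _ _ ord0 (fun j => r j - 1) n r1.
(* For t = 1 the main sum stops at the empty set, and the first factor enters through the odd
   correction term. For t at least 2 the main sum already contains it, and the correction vanishes
   because its sets are nonempty and avoid [ord0]. *)
case: t t0 => [|[|t]] // _.
  rewrite /= big_nat1.
  rewrite (eq_bigl (pred1 finset.set0)); last by move=> I; rewrite /= cards_eq0.
  rewrite big_pred1_eq big_set0.
  rewrite (eq_bigl (pred1 finset.set0)); last first.
    move=> I; rewrite /= cards_eq0 andb_idl // => /eqP ->.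
    by rewrite finset.in_set0.
  by rewrite big_pred1_eq big_set0 -r0; ring.
rewrite /= negbK main big1 ?mulr0 ?addr0 ?r0 => [|I /andP[I0 cI]].
  by rewrite subrKC if_same.
have /set0Pn[j jI] : I != finset.set0 by rewrite -cards_eq0 (eqP cI).
rewrite (bigD1 j) //= r1 ?mul0r //.
by apply: contraNneq I0 => <-.
Qed.

Local Close Scope ring_scope.

Theorem theorem4p12 (k t a1 b1 N1 N2 : nat) (s : k.-tuple nat)
  (ht : 1 <= t <= k.+1)
  (ha1 : 0 < a1) (hb1 : 0 < b1)
  (hs : forall i : 'I_k, 0 < tnth s i)
  (hN1 : 0 < N1) (hN2 : 0 < N2)
  (hN : (N1%:R / a1%:R = N2%:R / b1%:R :> rat)%R)
  (hA : exists A : {mset oa_row k.+1}, is_OA N1 [tuple of a1 :: s] t A)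
  (hB : exists B : {mset oa_row k.+1}, is_OA N2 [tuple of b1 :: s] t B) :
  exists C : {mset oa_row k.+1},
    is_optimal_NOA (N1 + N2) N1 [tuple of (a1 + b1) :: s] [tuple of a1 :: s] t C.
Proof.
have a1_neq0 : (a1%:R != 0 :> rat)%R by rewrite pnatr_eq0 -lt0n.
have b1_neq0 : (b1%:R != 0 :> rat)%R by rewrite pnatr_eq0 -lt0n.
have eqN : N1 * b1 = N2 * a1.
  by move/eqP: hN; rewrite eqr_div // -!natrM eqr_nat => /eqP.
have [A hA'] := hA; have [B hB'] := hB; have [t0 _] := andP ht.
exists (stack k a1 A B); split.
- split.
  + move=> i; case: (unliftP ord0 i) => [j ->|->]; last by rewrite !tnth0 ha1 leq_addr.
    by rewrite !tnthS hs leqnn.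
  + by exists ord0; rewrite !tnth0 -addn1 leq_add2l.
  + exact: is_OA_stack eqN hA' hB'.
  (* The nested subarray is [A] itself: stacking can only increase multiplicities. *)
  + exists A => //; apply/msubsetP => x.
    by rewrite mset_seqE count_cat count_mem_mset leq_addr.
- move=> i; rewrite /level_ratio; case: (unliftP ord0 i) => [j ->|->] //.
  rewrite !tnthS !tnth0 divff ?pnatr_eq0 -?lt0n //.
  by rewrite ler_pdivlMr ?ltr0n // mul1r ler_nat leq_addr.
(* The bound expands to N1 + b1 (N1 / a1), and [hN] turns the second term into N2. *)
- rewrite NOA_bound_single_factor // !natrD mulrDl divff // mulrDr mulr1.
  by rewrite mulrCA hN [X in _ = (_ + X)%R]mulrC divfK.
Qed.
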